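(* Let $n > 51$ be an integer such that none of $n$, $n-1$, $n-2$, $n/2$, $(n-1)/2$, $(n-2)/2$ is a prime number. Let $\alpha, \beta \in A_n$ have prime orders $p$ and $q$ respectively, and let $\alpha = \alpha_1 \cdots \alpha_m$ and $\beta = \beta_1 \cdots \beta_{m'}$ be their factorizations into disjoint (nontrivial) cycles. If $pq \leq 9$, then $d(\alpha,\beta) \leq 6$, where $d$ denotes the distance in $\mathcal{P}^*(A_n)$.
   Context: $A_n$ is the alternating group on $\{1,\dots,n\}$. For a finite group $G$, the power graph $\mathcal{P}(G)$ is the simple undirected graph with vertex set $G$ in which two distinct elements $x \neq y$ are adjacent if and only if $y = x^m$ or $x = y^m$ for some positive integer $m$. The proper power graph $\mathcal{P}^*(G)$ is the graph obtained from $\mathcal{P}(G)$ by deleting the vertex $1$ (the identity element). The distance $d(x,y)$ is the length (number of edges) of a shortest path joining $x$ and $y$ in $\mathcal{P}^*(A_n)$. Since $\alpha$ has prime order $p$, each cycle $\alpha_i$ is a $p$-cycle; likewise each $\beta_j$ is a $q$-cycle. *)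

(* Defs.v *)
From mathcomp Require Import all_boot all_fingroup all_solvable.

Set Implicit Arguments.
Unset Strict Implicit.
Unset Printing Implicit Defensive.

Import GroupScope.

Section Distance.
Variables (T : finType) (e : rel T).

Definition has_path (x y : T) (k : nat) : bool :=
  [exists p : k.-tuple T, [&& path e x p, last x p == y & uniq (x :: p)]].

(* [None] stands for an infinite distance. Paths have distinct vertices, so   *)
(* their lengths are smaller than #|T|.                                       *)
Definition dist (x y : T) : option nat :=
  if [pick k : 'I_#|T| | has_path x y k] is Some k0
  then Some (val [arg min_(k < k0 | has_path x y k) val k])
  else None.

Definition dist_le (x y : T) (k : nat) : bool :=
  if dist x y is Some d then d <= k else false.

Lemma dist_leP x y k :
  reflect (exists p, [/\ path e x p, last x p = y & size p <= k])
          (dist_le x y k).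
Proof.
have pathP j : reflect (exists p, [/\ path e x p, last x p = y, uniq (x :: p)
                                    & size p = j]) (has_path x y j).
  apply: (iffP existsP) => [[p /and3P[? /eqP ? ?]]|[p [? ? ? sp]]].
    by exists p; split=> //; rewrite size_tuple.
  by move/eqP: sp => sp; exists (Tuple sp); apply/and3P; split=> //; apply/eqP.
rewrite /dist_le /dist; case: pickP => [k0 hk0|none].
  case: arg_minnP => //= d hd dmin; apply: (iffP idP) => [led|].
    by have /pathP[p [? ? _ sp]] := hd; exists p; rewrite sp.
  case=> p [ep lp sp]; case/shortenP: ep lp => p' ep' up' /uniq_leq_size sub lp.
  have ltp : size p' < #|T| by rewrite -[(size p').+1]/(size (x :: p')) -(card_uniqP up') max_card.
  have := dmin (Ordinal ltp); rewrite /= => le_d.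
  apply: leq_trans (le_d _) _; first by apply/pathP; exists p'; split.
  by apply: leq_trans sp; apply: sub; have /andP[] := up'.
constructor=> -[p [ep lp _]]; case/shortenP: ep lp => p' ep' up' _ lp.
have ltp : size p' < #|T| by rewrite -[(size p').+1]/(size (x :: p')) -(card_uniqP up') max_card.
by have /negP[] := negbT (none (Ordinal ltp)); apply/pathP; exists p'; split.
Qed.

End Distance.

Section PowerGraph.
Variable gT : finGroupType.

Lemma pos_power_dec (x y : gT) : decidable (exists2 m, 0 < m & y = x ^+ m).
Proof.
apply: (@decP _ (y \in <[x]>)); apply: (iffP (cycleP x y)) => [[i ->]|[m _ ->]].
  by exists (i + #[x]); rewrite ?addn_gt0 ?order_gt0 ?orbT // expgD expg_order mulg1.
by exists m.
Qed.

Definition power_graph (G : {set gT}) : rel gT :=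
  [rel x y | [&& x \in G, y \in G, x != y
               & pos_power_dec x y || pos_power_dec y x]].

(* The subgraph of the power graph of G induced on the non-identity elements. *)
Definition proper_power_graph (G : {set gT}) : rel gT :=
  [rel x y | [&& x != 1, y != 1 & power_graph G x y]].

End PowerGraph.

Section Cycles.
Variable T : finType.

Definition perm_support (s : {perm T}) : {set T} := [set x | s x != x].

Definition is_cycle (s : {perm T}) : Prop :=
  exists2 x, s x != x & perm_support s = porbit s x.

Definition cycle_factorization (s : {perm T}) (m : nat)
    (c : 'I_m -> {perm T}) : Prop :=
  [/\ forall i, is_cycle (c i),
      forall i j, i != j -> [disjoint perm_support (c i) & perm_support (c j)]
    & s = \prod_(i < m) c i].

End Cycles.

(* Main.v *)
(** Two commuting elements a, b of distinct prime orders are joined by the path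
    a, ab, b, so it suffices to find c, d with alpha, c, d, beta consecutively
    commuting and of distinct consecutive prime orders. Here the orders of alpha
    and beta are 2 or 3. An element of order r commuting with a permutation s of
    prime order arises by permuting among themselves a few cycles, or a few fixed
    points, of s; with few points to avoid, c and d can be taken with disjoint
    supports. *)

Require Import Defs.
From mathcomp Require Import all_boot all_fingroup all_solvable.
From mathcomp Require Import zify.

(** * Paths in the proper power graph through commuting elements of prime order *)

Section PrimeOrderElements.
Import GroupScope.
Set Implicit Arguments.
Unset Strict Implicit.
Variable gT : finGroupType.

(** The orders are coprime, so the cyclic group of [a * b] is the product of those of [a] and [b];
    hence both are powers of [a * b]. *)
Lemma coprime_commute_path (G : {group gT}) (a b : gT) :
    a \in G -> b \in G -> prime #[a] -> prime #[b] -> #[a] != #[b] ->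
    commute a b ->
  proper_power_graph G a (a * b) && proper_power_graph G (a * b) b.
Proof.
move=> aG bG pa pb neq_ab cab.
have co_ab : coprime #[a] #[b] by rewrite prime_coprime // dvdn_prime2.
have a1 : a != 1 by rewrite -order_gt1 prime_gt1.
have b1 : b != 1 by rewrite -order_gt1 prime_gt1.
have ab1 : a * b != 1.
  by apply: contra neq_ab; rewrite -eq_invg_mul => /eqP <-; rewrite orderV.
have pos_powP (x y : gT) : y \in <[x]> -> (pos_power_dec x y : bool).
  (* The exponent [i] may be 0; adding the order makes it positive. *)
  move=> /cycleP[i ->]; apply/sumboolP; exists (i + #[x])%N.
    by rewrite addn_gt0 order_gt0 orbT.
  by rewrite expgD expg_order mulg1.
have cycE := cycleM cab co_ab.
have a_ab : a \in <[a * b]> by rewrite cycE -{1}[a]mulg1 mem_mulg ?cycle_id.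
have b_ab : b \in <[a * b]> by rewrite cycE -{1}[b]mul1g mem_mulg ?cycle_id.
have neq_aab : a != a * b by rewrite -{1}[a]mulg1 (inj_eq (mulgI a)) eq_sym.
have neq_abb : a * b != b by rewrite -{2}[b]mul1g (inj_eq (mulIg b)).
rewrite /proper_power_graph /power_graph /= a1 b1 ab1 aG bG groupM //.
by rewrite neq_aab neq_abb (pos_powP _ _ a_ab) (pos_powP _ _ b_ab) !orbT.
Qed.

Lemma dist_le6_of_commuting (G : {group gT}) (a b c d : gT) :
    [/\ a \in G, b \in G, c \in G & d \in G] ->
    [/\ prime #[a], prime #[b], prime #[c] & prime #[d]] ->
    [/\ #[a] != #[b], #[b] != #[c] & #[c] != #[d]] ->
    [/\ commute a b, commute b c & commute c d] ->
  dist_le (proper_power_graph G) a d 6.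
Proof.
case=> aG bG cG dG [pa pb pc pd] [ab bc cd] [cab cbc ccd].
apply/dist_leP; exists [:: a * b; b; b * c; c; c * d; d]; split=> //.
have /andP[h1 h2] := coprime_commute_path aG bG pa pb ab cab.
have /andP[h3 h4] := coprime_commute_path bG cG pb pc bc cbc.
have /andP[h5 h6] := coprime_commute_path cG dG pc pd cd ccd.
by rewrite /path h1 h2 h3 h4 h5 h6.
Qed.

Lemma expg_prod (I : finType) (F : I -> gT) (r : nat) (s : seq I) :
    (forall i j, commute (F i) (F j)) ->
  (\prod_(i <- s) F i) ^+ r = \prod_(i <- s) F i ^+ r.
Proof.
move=> cF; elim: s => [|i s IH]; first by rewrite !big_nil expg1n.
rewrite !big_cons expgMn ?IH //.
elim: s {IH} => [|j s IH]; first by rewrite big_nil; apply: commute1.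
by rewrite big_cons; apply: commuteM.
Qed.

End PrimeOrderElements.

(** * Even permutations of prime order commuting with a given permutation *)

Section CommutingEvenPermutations.
Import GroupScope.
Set Implicit Arguments.
Unset Strict Implicit.
Variable T : finType.
Implicit Types (s c rho : {perm T}) (S X : {set T}).

(** Cauchy's theorem in the even part of the symmetric group on [X]; the factor 2 pays for the index
    of that part. *)
Lemma exists_Alt_order_perm_on X r :
    prime r -> (2 * r)%N %| #|X|`! ->
  exists c, [/\ c \in 'Alt_T, #[c] = r & perm_on X c].
Proof.
move=> pr dv.
have gH : group_set [set u : {perm T} | perm_on X u].
  apply/group_setP; split=> [|u v]; rewrite !inE ?perm_on1 //.
  exact: perm_onM.
pose H := Group gH.
have cH : #|H| = #|X|`! by rewrite -card_perm cardsE.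
have T_gt1 : (1 < #|T|)%N.
  have: (1 < #|X|)%N.
    have r2 := prime_gt1 pr.
    move: dv; case: #|X| => [|[|k]] // /dvdn_leq -/(_ isT);
      by rewrite (_ : _`! = 1%N) //; lia.
  by move/leq_trans; apply; apply: max_card.
have leH : (#|H| <= 2 * #|H :&: 'Alt_T|)%N.
  rewrite -(leq_pmul2r (cardG_gt0 'Alt_T)) mul_cardG.
  rewrite -mulnA [(#|_ :&: _| * _)%N]mulnC mulnA leq_mul2r card_Alt //.
  rewrite -card_Sym subset_leq_card ?orbT //.
  by apply/subsetP=> x _; rewrite inE.
(* The index [k] of the even part is 1 or 2, and either divides 2. *)
have dvI : #|H| %| (2 * #|H :&: 'Alt_T|)%N.
  have /dvdnP[k kE] := cardSg (subsetIl H 'Alt_T).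
  move: leH; rewrite kE leq_pmul2r ?cardG_gt0 //.
  case: k kE => [|[|[|k]]] kE // _; rewrite ?dvdn_mul //.
  by have := cardG_gt0 H; rewrite kE.
have: r %| #|H :&: 'Alt_T|.
  by rewrite -(@dvdn_pmul2l 2) //; apply: dvdn_trans dvI; rewrite cH.
case/(Cauchy pr)=> c /setIP[]; rewrite inE => ? ? ?.
by exists c.
Qed.

Lemma card_porbit_le s x : (#|porbit s x| <= #[s])%N.
Proof. by rewrite porbitE; apply: leq_imset_card. Qed.

(** Greedy choice: each chosen point costs its orbit, at most [#[s]] points. *)
Lemma exists_orbit_representatives s (M : {set T}) k :
    (#[s] * k < #|M|)%N ->
  exists X, [/\ X \subset M, #|X| = k.+1
    & {in X &, forall x y, y \in porbit s x -> x = y}].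
Proof.
elim: k M => [|k IH] M ltM.
  have /card_gt0P[x xM] : (0 < #|M|)%N by apply: leq_ltn_trans ltM.
  exists [set x]; rewrite sub1set cards1; split=> // y z.
  by move=> /set1P-> /set1P->.
have /card_gt0P[x xM] : (0 < #|M|)%N by apply: leq_ltn_trans ltM.
have [|X [/subsetP sXM cX sepX]] := IH (M :\: porbit s x).
  have := card_porbit_le s x; have := cardsID (porbit s x) M.
  have := subset_leq_card (subsetIr M (porbit s x)).
  by move: ltM; rewrite mulnS; lia.
have notin y : y \in X -> y \notin porbit s x by move/sXM/setDP=> [].
exists (x |: X); split.
- by rewrite subUset sub1set xM; apply/subsetP=> y /sXM/setDP[].
- by rewrite cardsU1 cX (contraTN (@notin x)) ?porbit_id.
- move=> y z /setU1P[->|yX] /setU1P[->|zX] //.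
  + by move=> zx; have := notin z zX; rewrite zx.
  + by rewrite porbit_sym => yx; have := notin y yX; rewrite yx.
  + exact: sepX.
Qed.

Lemma perm_on_sub X (Y : {set T}) c : X \subset Y -> perm_on X c -> perm_on Y c.
Proof. by move=> sXY cX; apply: subset_trans cX sXY. Qed.

Lemma perm_onJ X c s : perm_on X c -> perm_on (s @: X) (c ^ s).
Proof.
move=> cX; apply/subsetP=> y; rewrite inE -[y](permKV s) permJ => ney.
rewrite mem_imset; last exact: perm_inj.
by apply: (subsetP cX); apply: contra ney => /eqP->.
Qed.

Lemma perm_on_prod (I : finType) (F : I -> {perm T}) X :
  (forall i, perm_on X (F i)) -> perm_on X (\prod_i F i).
Proof.
by move=> h; elim/big_ind: _ => //; [apply: perm_on1 | move=> *; apply: perm_onM].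
Qed.

Lemma prime_order_exp_fix s x i :
  prime #[s] -> 0 < i < #[s] -> (s ^+ i) x = x -> s x = x.
Proof.
move=> ps /andP[i0 ip] fx.
have: generator <[s]> (s ^+ i).
  by rewrite generator_coprime prime_coprime // gtnNdvd.
rewrite /generator => /eqP cE.
have /cycleP[k sE] : s \in <[s ^+ i]> by rewrite -cE cycle_id.
by rewrite sE permX iter_fix.
Qed.

(** A common point comes from two points of [X] in one orbit, hence from a single [x], which
    [s ^+ (j - i)] would fix; that power generates the group of [s], yet [s] moves [x]. *)
Lemma disjoint_translates s X i j :
    prime #[s] -> {in X, forall x, s x != x} ->
    {in X &, forall x y, y \in porbit s x -> x = y} ->
    (i < j < #[s])%N ->
  [disjoint [set (s ^+ i) x | x in X] & [set (s ^+ j) x | x in X]].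
Proof.
move=> ps mvX sepX /andP[ij jp]; apply/pred0P=> z /=; apply/negP.
case/andP=> /imsetP[x xX ->] /imsetP[y yX eqxy].
have xy : x = y.
  apply: sepX => //; rewrite -eq_porbit_mem -(porbit_perm s i x) eqxy.
  by rewrite porbit_perm.
have := mvX x xX; rewrite (@prime_order_exp_fix s x (j - i)) ?eqxx //; first by lia.
apply: (@perm_inj _ (s ^+ i)); rewrite -permM -expgD subnK ?(ltnW ij) //.
by rewrite eqxy xy.
Qed.

(* The product of the conjugates of [c] by the powers of [s]: they have
   disjoint supports, and conjugation by [s] permutes them cyclically. *)
Lemma exists_commuting_spread s X c r :
    prime #[s] -> {in X, forall x, s x != x} ->
    {in X &, forall x y, y \in porbit s x -> x = y} ->
    prime r -> c \in 'Alt_T -> #[c] = r -> perm_on X c ->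
  exists rho, [/\ rho \in 'Alt_T, #[rho] = r, commute s rho
                & perm_on (\bigcup_(x in X) porbit s x) rho].
Proof.
move=> ps mvX sepX pr cAlt oc cX.
pose F i := c ^ (s ^+ i).
pose rho := \prod_(i < #[s]) F i.
have FX i : perm_on [set (s ^+ i) x | x in X] (F i) by apply: perm_onJ.
have cF (i j : 'I_#[s]) : commute (F i) (F j).
  have lt_commute (k l : 'I_#[s]) : (k < l)%N -> commute (F k) (F l).
    move=> kl; apply: perm_onC (FX k) (FX l) _.
    by apply: disjoint_translates; rewrite ?kl /=.
  have [ij|ji|/val_inj->] := ltngtP i j; rewrite /commute //.
  - exact: lt_commute.
  - by apply/commute_sym/lt_commute.
have [n ordE] : exists n, #[s] = n.+1 by exists #[s].-1; rewrite prednK ?order_gt0.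
(* The factors other than [c] itself live off [X], so [rho] agrees with [c] on [X] and cannot be
   trivial. *)
pose t := \prod_(i < n) F i.+1.
have rhoE : rho = c * t.
  by rewrite /rho ordE big_ord_recl /F expg0 conjg1.
have tX : perm_on (~: X) t.
  apply: perm_on_prod => i; apply: perm_on_sub (FX _).
  rewrite -disjoints_subset disjoint_sym.
  have := @disjoint_translates s X 0 i.+1 ps mvX sepX.
  rewrite expg0 (_ : [set (1 : {perm T}) x | x in X] = X).
    by apply; rewrite ordE /= ltnS ltn_ord.
  by rewrite -[RHS]imset_id; apply: eq_imset => x; rewrite perm1.
have ct : commute c t.
  by apply: perm_onC cX tX _; rewrite -subsets_disjoint.
exists rho; split.
- by apply: group_prod => i _; rewrite Alt_even /F odd_permJ -Alt_even.
- apply: nt_prime_order => //.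
    rewrite expg_prod // big1 // => i _.
    by rewrite -conjXg -oc expg_order conj1g.
  apply/eqP=> rho1; have: c != 1 by rewrite -order_gt1 oc prime_gt1.
  case/eqP; apply/permP=> x; rewrite perm1.
  have [xX|] := boolP (x \in X); last by move/(out_perm cX).
  have := out_perm tX (x := c x); rewrite inE negbK (perm_closed x cX) => /(_ xX).
  by rewrite -permM -rhoE rho1 perm1.
(* Conjugation by [s] shifts the indices by one; the last factor wraps around to [c], turning
   [c * t] into [t * c]. *)
- apply/commute_sym/commgP/conjg_fixP.
  rewrite /rho (big_morph (fun u => u ^ s) (fun u v => conjMg u v s) (conj1g s)).
  under eq_bigr => i _ do rewrite /F -conjgM -expgSr.
  by rewrite -/rho rhoE ct ordE big_ord_recr /= -ordE expg_order conjg1.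
- apply: perm_on_prod => i; apply: perm_on_sub (FX i).
  apply/subsetP=> y /imsetP[x xX ->]; apply/bigcupP; exists x => //.
  exact: mem_porbit.
Qed.

Lemma card_bigcup_porbit_le s X :
  (#|\bigcup_(x in X) porbit s x| <= #[s] * #|X|)%N.
Proof.
rewrite mulnC -sum_nat_const; elim/big_rec2: _ => [|x k U _ leU].
  by rewrite cards0.
by apply: leq_trans (leq_card_setU _ _) _; rewrite leq_add ?card_porbit_le.
Qed.

(** [S] holds the points to avoid. Dropping every orbit that meets [S] costs at most [#[s] * #|S|]
    moved points; the rest still supplies [k.+1] cycles of [s] to permute. *)
Lemma exists_commuting_on_moved s S r k :
    prime #[s] -> prime r -> (2 * r)%N %| k.+1`! ->
    (#[s] * (k + #|S|) < #|[set x | s x != x]|)%N ->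
  exists rho U, [/\ rho \in 'Alt_T, #[rho] = r, commute s rho
    & [/\ perm_on U rho, [disjoint U & S] & (#|U| <= #[s] * k.+1)%N]].
Proof.
move=> ps pr dv; set M := [set x | _] => ltM.
pose V := \bigcup_(x in S) porbit s x.
have [|X [/subsetP sXM cX sepX]] := @exists_orbit_representatives s (M :\: V) k.
  have := card_bigcup_porbit_le s S; rewrite -/V.
  have := cardsID V M; have := subset_leq_card (subsetIr M V).
  by move: ltM; rewrite mulnDr; lia.
have [|c [cAlt oc cX']] := @exists_Alt_order_perm_on X r pr; first by rewrite cX.
have mvX : {in X, forall x, s x != x} by move=> x /sXM/setDP[]; rewrite inE.
have [rho [rAlt or crho rhoU]] :=
  exists_commuting_spread ps mvX sepX pr cAlt oc cX'.
exists rho, (\bigcup_(x in X) porbit s x); split=> //; split=> //.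
  apply/pred0P=> z /=; apply/negP=> /andP[/bigcupP[x xX zx] zS].
  have /setDP[_ /negP] := sXM x xX; apply; apply/bigcupP; exists z => //.
  by rewrite porbit_sym.
by rewrite -cX card_bigcup_porbit_le.
Qed.

Lemma exists_commuting_on_fixed s S r k :
    prime r -> (2 * r)%N %| k.+1`! ->
    (k + #|S| < #|[set x | s x == x]|)%N ->
  exists rho U, [/\ rho \in 'Alt_T, #[rho] = r, commute s rho
    & [/\ perm_on U rho, [disjoint U & S] & (#|U| <= k.+1)%N]].
Proof.
move=> pr dv; set F := [set x | _] => ltF.
have /card_geqP[xs [uxs szxs sub_xs]] : (k.+1 <= #|F :\: S|)%N.
  have := cardsID S F; have := subset_leq_card (subsetIr F S); lia.
pose X := [set x in xs].
have sXF x : x \in X -> s x = x /\ x \notin S.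
  by rewrite inE => /sub_xs/setDP[]; rewrite inE => /eqP.
have cX : #|X| = k.+1 by rewrite cardsE (card_uniqP uxs).
have [|c [cAlt oc cX']] := @exists_Alt_order_perm_on X r pr; first by rewrite cX.
exists c, X; rewrite cX; split=> //; last first.
  by split=> //; apply/pred0P=> x /=; apply/negP=> /andP[/sXF[_ /negP]].
have sM : perm_on [set x | s x != x] s by apply/subsetP=> x; rewrite inE.
apply: perm_onC sM cX' _; apply/pred0P=> x /=; apply/negP.
by rewrite inE => /andP[nfx /sXF[fx _]]; rewrite fx eqxx in nfx.
Qed.

Lemma card_moved_fixed s :
  (#|[set x | s x != x]| + #|[set x | s x == x]|)%N = #|T|.
Proof.
rewrite -(cardsC [set x | s x != x]); congr (_ + _)%N.
by apply: eq_card => x; rewrite !inE negbK.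
Qed.

(** Pigeonhole: if neither the moved nor the fixed points sufficed, [T] would have at most [(#[s] +
    1) * (k + #|S|)] points. *)
Lemma exists_commuting s S r k :
    prime #[s] -> prime r -> (2 * r)%N %| k.+1`! ->
    ((#[s]).+1 * (k + #|S|) < #|T|)%N ->
  exists rho U, [/\ rho \in 'Alt_T, #[rho] = r, commute s rho
    & [/\ perm_on U rho, [disjoint U & S] & (#|U| <= #[s] * k.+1)%N]].
Proof.
move=> ps pr dv; rewrite -(card_moved_fixed s) mulSn addnC => ltT.
have [ltM|leM] := ltnP (#[s] * (k + #|S|)) #|[set x | s x != x]|.
  exact: exists_commuting_on_moved.
have [|rho [U [rAlt or crho [rU dU cU]]]] :=
  @exists_commuting_on_fixed s S r k pr dv.
  by lia.
exists rho, U; split=> //; split=> //; apply: leq_trans cU _.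
by rewrite leq_pmull ?prime_gt0.
Qed.

(** * Distance bounds for elements of orders 2 and 3 *)

Lemma dist_le6_order2 (a b : {perm T}) :
    a \in 'Alt_T -> b \in 'Alt_T -> (51 < #|T|)%N ->
    #[a] = 2 -> #[b] = 2 \/ #[b] = 3 ->
  dist_le (proper_power_graph 'Alt_T) a b 6.
Proof.
move=> aG bG nT oa ob.
have pa : prime #[a] by rewrite oa.
have pb : prime #[b] by case: ob => ->.
(* The orders along the chain are 2, 3, 5, [#[b]]. A 3-cycle of 2-cycles of [a] occupies at most 6
   points, and then at most 4 * (4 + 6) = 40 < 52 is required for [d]. *)
have [||c [U [cG oc ac [cU _ leU]]]] := @exists_commuting a set0 3 2 pa isT.
- by [].
- by rewrite oa cards0; lia.
have [||d [V [dG od bd [dV dVU _]]]] := @exists_commuting b U 5 4 pb isT.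
- by [].
- by rewrite oa in leU; case: ob => ->; lia.
apply: (@dist_le6_of_commuting _ 'Alt_T a c d b); rewrite ?oc ?od ?oa //.
  by split=> //; case: ob => ->.
by split=> //; apply: perm_onC cU dV _; rewrite disjoint_sym.
Qed.

(* With at least four fixed points, the double transposition for [b] is chosen
   there, leaving room for a 5-element for [a]; otherwise [b] moves at least 49
   points, enough to avoid the at most 12 points moved by the involution
   chosen for [a]. *)
Lemma dist_le6_order3 (a b : {perm T}) :
    a \in 'Alt_T -> b \in 'Alt_T -> (51 < #|T|)%N ->
    #[a] = 3 -> #[b] = 3 ->
  dist_le (proper_power_graph 'Alt_T) a b 6.
Proof.
move=> aG bG nT oa ob.
have pa : prime #[a] by rewrite oa.
have pb : prime #[b] by rewrite ob.
(* Without this split, [exists_commuting] would need more than 4 * (4 + 12) = 64 points for the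
   5-element. An even involution takes four points, as 4 does not divide 3!. *)
have [ltF|leF] := ltnP 3 #|[set x | b x == x]|.
  have [||d [V [dG od bd [dV _ leV]]]] :=
    @exists_commuting_on_fixed b set0 2 3 isT.
  - by [].
  - by rewrite cards0.
  have [||c [U [cG oc ac [cU dUV _]]]] := @exists_commuting a V 5 4 pa isT.
  - by [].
  - by rewrite oa; lia.
  apply: (@dist_le6_of_commuting _ 'Alt_T a c d b); rewrite ?oc ?od ?oa ?ob //.
  by split=> //; apply: perm_onC cU dV dUV.
have := card_moved_fixed b => cMF.
have [||c [U [cG oc ac [cU _ leU]]]] := @exists_commuting a set0 2 3 pa isT.
- by [].
- by rewrite oa cards0; lia.
have [||d [V [dG od bd [dV dVU _]]]] :=
  @exists_commuting_on_moved b U 5 4 pb isT.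
- by [].
(* At least 52 - 3 = 49 points are moved, just above the required 3 * (4 + 12) = 48. *)
- by rewrite oa in leU; rewrite ob; lia.
apply: (@dist_le6_of_commuting _ 'Alt_T a c d b); rewrite ?oc ?od ?oa ?ob //.
by split=> //; apply: perm_onC cU dV _; rewrite disjoint_sym.
Qed.

End CommutingEvenPermutations.

Lemma dist_le_sym (T : finType) (e : rel T) (x y : T) k :
  symmetric e -> dist_le e x y k -> dist_le e y x k.
Proof.
move=> symE /dist_leP[p [ep lp sp]]; apply/dist_leP.
exists (rev (belast x p)); split.
- by rewrite -lp rev_path; under eq_path => u v do rewrite symE.
- by rewrite -lp; case: p {ep lp sp} => //= z p; rewrite rev_cons last_rcons.
- by rewrite size_rev size_belast.
Qed.

Lemma proper_power_graph_sym (gT : finGroupType) (G : {set gT}) :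
  symmetric (proper_power_graph G).
Proof.
move=> x y; rewrite /proper_power_graph /power_graph /= [x == y]eq_sym.
by rewrite [pos_power_dec x y || _]orbC; do !bool_congr.
Qed.

Theorem lemma2p3 (n : nat) (n_gt51 : 51 < n)
  (n0_nprime : ~~ prime n)
  (n1_nprime : ~~ prime (n - 1))
  (n2_nprime : ~~ prime (n - 2))
  (n0_half_nprime : ~~ ((2 %| n) && prime (n %/ 2)))
  (n1_half_nprime : ~~ ((2 %| n - 1) && prime ((n - 1) %/ 2)))
  (n2_half_nprime : ~~ ((2 %| n - 2) && prime ((n - 2) %/ 2)))
  (alpha beta : {perm 'I_n})
  (alpha_alt : alpha \in ('Alt_('I_n))%g)
  (beta_alt : beta \in ('Alt_('I_n))%g)
  (p q : nat) (p_prime : prime p) (q_prime : prime q)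
  (alpha_order : #[alpha]%g = p) (beta_order : #[beta]%g = q)
  (m : nat) (alpha_ : 'I_m -> {perm 'I_n})
  (alpha_cycles : cycle_factorization alpha alpha_)
  (m' : nat) (beta_ : 'I_m' -> {perm 'I_n})
  (beta_cycles : cycle_factorization beta beta_)
  (pq_le9 : p * q <= 9) :
  dist_le (proper_power_graph ('Alt_('I_n))%g) alpha beta 6.
Proof.
have nT : 51 < #|'I_n| by rewrite card_ord.
have le3 r s : prime r -> prime s -> s * r <= 9 -> r = 2 \/ r = 3.
  move=> r_prime /prime_gt1 s_gt1 le9.
  have : r <= 4 by nia.
  by case: r r_prime {le9} => [|[|[|[|[|r]]]]] //; auto.
have q23 := le3 _ _ q_prime p_prime pq_le9.
have p23 : p = 2 \/ p = 3 by apply: le3 p_prime q_prime _; rewrite mulnC.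
case: p23 => pE.
  by apply: dist_le6_order2 => //; rewrite ?alpha_order ?beta_order.
case: q23 => qE.
  (* Orders 3 and 2: the path is built from [beta] and reversed. *)
  apply: dist_le_sym; first exact: proper_power_graph_sym.
  by apply: dist_le6_order2; rewrite ?alpha_order ?beta_order //; right.
by apply: dist_le6_order3; rewrite ?alpha_order ?beta_order.
Qed.
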